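(* Let $F$ be a continuous distribution function on $\mathbb{R}$, and let $G:=F\ast F$ be the distribution function of $S+T$ where $S,T$ are i.i.d. with distribution function $F$. For $(v,t)\in(0,1)^2$ define $k_v(t):=F\big(G^{-1}(v)-F^{-1}(t)\big)$, and set $C(v,u):=\int_0^uk_v(t)\,dt$ for $v\in(0,1)$, $u\in[0,1]$, with $C(0,u)=0$, $C(1,u)=u$. Then $C$ is an SI copula satisfying $\mathcal{T}(C)=C$.
   Context: For a distribution function $H$ on $\mathbb{R}$, $H^{-1}(w):=\inf\{x: H(x)\ge w\}$. A bivariate copula $C$ is SI if $C(v,\cdot)$ is concave for all $v\in[0,1]$. $\Pi(u,v)=uv$; $\partial_2$ the partial derivative in the second argument; $D\vee E(u,v):=\int_0^1\min\{\partial_2D(u,t),\partial_2E(v,t)\}\,dt$; $\mathcal{T}(C):=C\vee\Pi$. *)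

(* Defs.v *)
From HB Require Import structures.
From mathcomp Require Import all_boot all_order all_algebra.
From mathcomp Require Import all_classical all_reals all_analysis.
Set Implicit Arguments. Unset Strict Implicit. Unset Printing Implicit Defensive.
Import Order.TTheory GRing.Theory Num.Theory.
Import numFieldNormedType.Exports.
Local Open Scope classical_set_scope.
Local Open Scope ring_scope.

Section defs.
Context {R : realType}.

Definition ginv (H : R -> R) (w : R) : R := inf [set x : R | w <= H x].

(* Stieltjes convolution G = F * F : G(x) = int F(x - s) dF(s),
   i.e. the distribution function of S + T with S, T iid ~ F *)
Definition conv_self (F : cumulativeBounded (0:R) (1:R)) (x : R) : R :=
  fine (\int[lebesgue_stieltjes_measure F]_(s in [set: measurableTypeR R])
          (F (x - s))%:E)%E.

Definition kfun (F : cumulativeBounded (0:R) (1:R)) (v t : R) : R :=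
  F (ginv (conv_self F) v - ginv F t).

Definition Cop (F : cumulativeBounded (0:R) (1:R)) (v u : R) : R :=
  if v <= 0 then 0 else if 1 <= v then u
  else Rintegral (@lebesgue_measure R) `[0, u] (kfun F v).

Definition unit_itv (x : R) := 0 <= x <= 1.

Definition is_copula (C : R -> R -> R) : Prop :=
  (forall u, unit_itv u ->
     C u 0 = 0 /\ C 0 u = 0 /\ C u 1 = u /\ C 1 u = u) /\
  (forall u1 u2 v1 v2, unit_itv u1 -> unit_itv u2 -> unit_itv v1 ->
     unit_itv v2 -> u1 <= u2 -> v1 <= v2 ->
     0 <= C u2 v2 - C u2 v1 - C u1 v2 + C u1 v1).

Definition is_SI (C : R -> R -> R) : Prop :=
  forall v, unit_itv v -> forall x y a, unit_itv x -> unit_itv y ->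
    unit_itv a -> a * C v x + (1 - a) * C v y <= C v (a * x + (1 - a) * y).

Definition Pi (u v : R) : R := u * v.

Definition partial2 (D : R -> R -> R) (u t : R) : R := derive1 (D u) t.

Definition cjoin (D E : R -> R -> R) (u v : R) : R :=
  Rintegral (@lebesgue_measure R) `[0, 1]
    (fun t => Num.min (partial2 D u t) (partial2 E v t)).

Definition Top (C : R -> R -> R) := cjoin C Pi.

End defs.

(* Main.v *)
Require Import Defs.
From HB Require Import structures.
From mathcomp Require Import all_boot all_order all_algebra.
From mathcomp Require Import all_classical all_reals all_analysis.
From mathcomp Require Import measurable_realfun ring lra.
Import Order.TTheory GRing.Theory Num.Theory.
Import numFieldNormedType.Exports.
Local Open Scope classical_set_scope.
Local Open Scope ring_scope.

(** Let G = F * F and k_u(t) = F(G^-1(u) - F^-1(t)). As F^-1 pushes the uniform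
    law on [0, 1] to the law with distribution function F, the integral of k_u
    over [0, 1] is G(G^-1(u)) = u, which gives the uniform margin; since k_u(t)
    increases in u and decreases in t, C is 2-increasing and concave in its
    second argument. The Galois connection w <= F x <-> F^-1 w <= x yields
      s <= k_u(t)  <->  F^-1 s + F^-1 t <= G^-1 u  <->  t <= k_u(s),
    so k_u is its own generalized inverse. The derivative of C(u, .) is k_u
    almost everywhere, and the integral of min(k_u, v) over [0, 1] is the area
    of {(t, s) | s < v, s <= k_u(t)}, which integrated in the other order is the
    integral of k_u over [0, v]. *)

(** * Generalized inverse of a continuous nondecreasing function *)

Section generalized_inverse.
Context {R : realType} (H : R -> R).
Hypothesis ndH : {homo H : x y / x <= y}.
Hypothesis cH : continuous H.
Hypothesis H_lt : forall w, 0 < w -> exists x, H x < w.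
Hypothesis H_gt : forall w, w < 1 -> exists x, w < H x.

Let has_lbound_ginv w : 0 < w -> has_lbound [set x : R | w <= H x].
Proof.
move=> /H_lt[y Hyw]; exists y => x /= wHx; rewrite leNgt; apply/negP => xy.
by have := lt_le_trans Hyw (le_trans wHx (ndH _ _ (ltW xy))); rewrite ltxx.
Qed.

Let nonempty_ginv w : w < 1 -> [set x : R | w <= H x] !=set0.
Proof. by move=> /H_gt[y wHy]; exists y; exact: ltW. Qed.

(** The infimum defining [ginv H w] is attained: otherwise continuity keeps [H] below [w] up to
    [ginv H w + e / 2], which would then be a lower bound exceeding the infimum. *)
Lemma ginv_le w x : 0 < w < 1 -> (ginv H w <= x) = (w <= H x).
Proof.
move=> /andP[w0 w1]; apply/idP/idP => [gx|wHx]; last first.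
  by apply: ge_inf => //; exact: has_lbound_ginv.
apply: le_trans (ndH _ _ gx); rewrite leNgt; apply/negP => Hgw.
have /nbhs_ballP[e /= e0 He] : \forall y \near ginv H w, H y < w.
  exact: (cvgr_lt (H (ginv H w)) (cH _)) _ Hgw.
have : ginv H w + e / 2 <= ginv H w.
  apply: lb_le_inf; first exact: nonempty_ginv.
  move=> y /= wHy; rewrite leNgt; apply/negP => yg.
  have : H (ginv H w + e / 2) < w.
    apply: He; rewrite /ball/= opprD addNKr normrN gtr0_norm ?divr_gt0//.
    by rewrite ltr_pdivrMr// ltr_pMr// ltr1n.
  by rewrite ltNge (le_trans wHy)// ndH// ltW.
by rewrite gerDl leNgt divr_gt0.
Qed.

Lemma ginv_homo w1 w2 : 0 < w1 < 1 -> 0 < w2 < 1 -> w1 <= w2 ->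
  ginv H w1 <= ginv H w2.
Proof.
by move=> ? ? w12; rewrite ginv_le// (le_trans w12)// -ginv_le.
Qed.

(** One inequality is the Galois connection. If the other failed, continuity would put
    [ginv H w - e / 2] in the superlevel set, to the left of its infimum. *)
Lemma ginvK w : 0 < w < 1 -> H (ginv H w) = w.
Proof.
move=> w01; apply/eqP; rewrite eq_le -ginv_le// lexx andbT leNgt.
apply/negP => wHg.
have /nbhs_ballP[e /= e0 He] : \forall y \near ginv H w, w < H y.
  exact: (cvgr_gt (H (ginv H w)) (cH _)) _ wHg.
have : w <= H (ginv H w - e / 2).
  apply/ltW/He; rewrite /ball/= opprB addrC subrK gtr0_norm ?divr_gt0//.
  by rewrite ltr_pdivrMr// ltr_pMr// ltr1n.
by rewrite -ginv_le// leNgt gtrBl divr_gt0.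
Qed.

End generalized_inverse.

(** * Integrals of almost everywhere equal functions, measurable or not *)

Section ae_eq_integral_nonmeasurable.
Local Open Scope ereal_scope.
Context d (T : measurableType d) (R : realType).
Variable mu : {measure set T -> \bar R}.
Import HBNNSimple.

(** The integral is a supremum over simple functions below the integrand. Cutting such a function
    [h <= f] to 0 on the measurable null set [N] preserves its integral and places it below [g]. *)
Let ae_le (f g : T -> \bar R) : (forall x, 0 <= f x) -> (forall x, 0 <= g x) ->
  {ae mu, forall x, f x = g x} -> \int[mu]_x f x <= \int[mu]_x g x.
Proof.
move=> f0 g0 [N [mN N0 fgN]].
rewrite !ge0_integralTE// ge_ereal_sup// => _ [h /= hf <-].
have mCN := measurableC mN.
apply: le_ereal_sup_tmp; exists (sintegral mu (h \_ (~` N))).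
  rewrite (mrestrict h mCN); exists (proj_nnsfun h mCN) => //= x.
  rewrite mindicE.
  have [xN|xN] := boolP (x \in ~` N); last by rewrite mulr0.
  rewrite mulr1 (le_trans (hf x))//.
  suff -> : f x = g x by [].
  by apply: contrapT => fg; move: xN; rewrite inE => /(_ (fgN x fg)).
rewrite -integralT_nnsfun -integral_nnsfun// (ge0_negligible_integral mN)//=.
- by rewrite setTD.
- exact/measurable_EFinP.
- by move=> x _; rewrite lee_fin.
Qed.

(* Unlike [ae_eq_integral], no measurability is required; it is not available
   for derivatives, because Lebesgue-null sets need not be Borel. *)
Lemma ae_eq_integral_nonmeasurable (D : set T) (f g : T -> \bar R) :
  {ae mu, forall x, D x -> f x = g x} ->
  \int[mu]_(x in D) f x = \int[mu]_(x in D) g x.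
Proof.
move=> fg; rewrite integral_mkcond [RHS]integral_mkcond.
have {}fg : {ae mu, forall x, (f \_ D) x = (g \_ D) x}.
  apply: filterS fg => x fgx; rewrite !patchE; case: ifPn => //.
  by rewrite inE => /fgx.
rewrite integralE [RHS]integralE; congr (_ - _);
  by apply/eqP; rewrite eq_le; apply/andP; split; apply: ae_le => //;
    apply: filterS fg => x; rewrite ?funeposE ?funenegE => ->.
Qed.

End ae_eq_integral_nonmeasurable.

(** * Primitives of nonincreasing functions with values in [0, 1] *)

Section nonincreasing_integrand.
Context {R : realType} (f : R -> R).
Notation mu := (@lebesgue_measure R).
Hypothesis f_noninc : nonincreasing_fun f.
Hypothesis f01 : forall x, 0 <= f x <= 1.

Let f_ge0 x : 0 <= f x. Proof. by have /andP[] := f01 x. Qed.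

Let mf D : measurable D -> measurable_fun D f.
Proof. by move=> mD; exact: nonincreasing_measurable. Qed.

Lemma integrable_nonincreasing (i : interval R) : (mu [set` i] < +oo)%E ->
  mu.-integrable [set` i] (EFin \o f).
Proof.
move=> ioo; apply: measurable_bounded_integrable => //; first exact: mf.
exists 1; split => // M M1 x _.
by rewrite /= ger0_norm// (le_trans _ (ltW M1))//; have /andP[] := f01 x.
Qed.

Let int_f (b0 b1 : bool) x y :
  mu.-integrable [set` Interval (BSide b0 x) (BSide b1 y)] (EFin \o f).
Proof.
apply: integrable_nonincreasing; rewrite lebesgue_measure_itv/=.
by case: ifPn => // _; rewrite -EFinB ltry.
Qed.

Lemma Rintegral_increment (x y : R) : 0 <= x -> x <= y ->
  \int[mu]_(t in `[0, y]) f t - \int[mu]_(t in `[0, x]) f t =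
  \int[mu]_(t in `]x, y]) f t.
Proof.
by move=> x0 xy; rewrite Rintegral_itvB// ?bnd_simp//; exact: int_f.
Qed.

Lemma Rintegral_nonincreasing_bounds (x y : R) : x <= y ->
  (y - x) * f y <= \int[mu]_(t in `]x, y]) f t <= (y - x) * f x.
Proof.
move=> xy.
have cst (c : R) : (y - x) * c = \int[mu]_(t in `]x, y]) c.
  rewrite Rintegral_cst//= lebesgue_measure_itv/= lte_fin mulrC.
  by move: xy; rewrite le_eqVlt => /predU1P[->|->]; rewrite ?ltxx ?subrr.
have intc (c : R) : mu.-integrable `]x, y] (EFin \o fun=> c).
  apply: measurable_bounded_integrable => //.
    by rewrite /= lebesgue_measure_itv/=; case: ifPn => // _; rewrite -EFinB ltry.
  by exists `|c|; split => // M cM t _; exact: ltW.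
rewrite !cst; apply/andP; split.
- apply: le_Rintegral => //= t.
  by rewrite in_itv/= => /andP[xt ty]; exact: f_noninc.
- apply: le_Rintegral => //= t.
  by rewrite in_itv/= => /andP[/ltW xt ty]; exact: f_noninc.
Qed.

(** With [z] the convex combination, the mean of [f] is at least [f z] on []x, z]] and at most [f z]
    on []z, y]]. Weighting the two increments by [a] and [1 - a] gives the common middle term
    [a * (1 - a) * (y - x) * f z]. *)
Lemma Rintegral_nonincreasing_concave (x y a : R) : 0 <= x -> 0 <= y -> 0 <= a <= 1 ->
  a * (\int[mu]_(t in `[0, x]) f t) + (1 - a) * (\int[mu]_(t in `[0, y]) f t)
  <= \int[mu]_(t in `[0, (a * x + (1 - a) * y)]) f t.
Proof.
wlog xy : x y a / x <= y => [wlg x0 y0 a01|].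
  have [xy|/ltW yx] := leP x y; first exact: wlg.
  have := wlg y x (1 - a) yx y0 x0; rewrite subKr ![_ + a * _]addrC; apply.
  by move: a01 => /andP[a0 a1]; rewrite subr_ge0 a1 lerBlDr lerDl.
move=> x0 y0 /andP[a0 a1]; set z := a * x + (1 - a) * y.
have a'0 : 0 <= 1 - a by rewrite subr_ge0.
have zx : z - x = (1 - a) * (y - x) by rewrite /z; ring.
have yz : y - z = a * (y - x) by rewrite /z; ring.
have xz : x <= z by rewrite -subr_ge0 zx mulr_ge0// subr_ge0.
have zy : z <= y by rewrite -subr_ge0 yz mulr_ge0// subr_ge0.
have /andP[+ _] := Rintegral_nonincreasing_bounds _ _ xz.
have /andP[_ +] := Rintegral_nonincreasing_bounds _ _ zy.
rewrite -(Rintegral_increment _ _ x0 xz) -(Rintegral_increment _ _ (le_trans x0 xz) zy).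
rewrite zx yz => /(ler_wpM2l a'0) + /(ler_wpM2l a0).
set Ix := \int[mu]_(t in `[0, x]) f t; set Iy := \int[mu]_(t in `[0, y]) f t.
set Iz := \int[mu]_(t in `[0, z]) f t.
by lra.
Qed.

(** Lebesgue's form of the fundamental theorem of calculus; the bound by 1 makes [f] locally
    integrable. *)
Lemma derive1_Rintegral_nonincreasing :
  {ae mu, forall t, 0 < t -> derive1 (fun x => \int[mu]_(s in `[0, x]) f s) t = f t}.
Proof.
have locf : locally_integrable [set: R] f.
  split; [exact: mf|exact: openT|move=> K _ cK].
  have := compact_finite_measure cK; have mK := compact_measurable cK.
  move=> Koo; apply: le_lt_trans Koo.
  rewrite -[leRHS]mul1e -integral_cst//; apply: ge0_le_integral => //.
  - by apply/measurable_EFinP/measurableT_comp => //; exact: mf.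
  - by move=> x _; rewrite lee_fin ger0_norm//; have /andP[] := f01 x.
have := FTC1 (a := BLeft 0) (fun y => int_f true false 0 y) locf.
apply: filterS; first exact: (ae_filter_ringOfSetsType mu).
by move=> t /= + t0; rewrite lte_fin => /(_ t0)[].
Qed.

End nonincreasing_integrand.

(** Used for the sections of the region under a graph and for the distribution function of the
    quantile transform. *)
Lemma lebesgue_measure_itvoo_itvNyc {R : realType} (w y : R) :
  0 <= w -> 0 <= y ->
  (@lebesgue_measure R (`]0%R, w[ `&` `]-oo, y]) = (Num.min y w)%:E)%E.
Proof.
move=> w0 y0; have [yw|wy] := ltP y w.
  rewrite (_ : _ `&` _ = `]0, y]%classic); last first.
    apply/seteqP; split => x /=; rewrite !in_itv/=.
      by move=> [/andP[-> _] ->].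
    by move=> /andP[-> xy]; rewrite xy (le_lt_trans xy yw).
  rewrite lebesgue_measure_itv/= lte_fin; case: ltgtP y0 => // [y0 _|<-//].
  by rewrite -EFinB subr0.
rewrite (_ : _ `&` _ = `]0, w[%classic); last first.
  apply/seteqP; split => x /=; rewrite !in_itv/=; first by case.
  by move=> /andP[-> xw]; rewrite xw (le_trans (ltW xw) wy).
rewrite lebesgue_measure_itv/= lte_fin; case: ltgtP w0 => // [w0 _|<-//].
by rewrite -EFinB subr0.
Qed.

(** * Area under a function that is its own generalized inverse *)

Section selfinverse_integrand.
Context {R : realType} (f : R -> R).
Notation mu := (@lebesgue_measure R).
Hypothesis f_noninc : nonincreasing_fun f.
Hypothesis f01 : forall x, 0 <= f x <= 1.
Hypothesis f_sym : forall s t, 0 < s < 1 -> 0 < t < 1 -> (s <= f t) = (t <= f s).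

(* Both sides are the area of {(t, s) | 0 < t < 1, 0 < s < v, s <= f t}. *)
Lemma Rintegral_min_selfinverse v : 0 <= v <= 1 ->
  \int[mu]_(t in `[0, 1]) Num.min (f t) v = \int[mu]_(t in `[0, v]) f t.
Proof.
move=> /andP[v0 v1].
have mfT : measurable_fun [set: R] f by exact: nonincreasing_measurable.
have area := @lebesgue_measure_itvoo_itvNyc R.
pose A := [set z : R * R | (0 < z.1 < 1) && (0 < z.2 < v) && (z.2 <= f z.1)].
have mA : measurable A.
  rewrite -[A]setTI.
  have : measurable_fun [set: R * R]
      (fun z : R * R => (0 < z.1 < 1) && (0 < z.2 < v) && (z.2 <= f z.1)).
    by repeat apply: measurable_and;
      (apply: measurable_fun_ltr || apply: measurable_fun_ler) => //;
      apply: measurableT_comp.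
  by move=> /(_ measurableT [set true]); exact.
(* The section at abscissa [t] is the part of []0, v[] below [f t]. *)
have area1 t : 0 < t < 1 ->
    (\int[mu]_s (\1_A (t, s))%:E = (Num.min (f t) v)%:E)%E.
  move=> t01; rewrite -area//; last by have /andP[] := f01 t.
  rewrite -[X in mu X]setIT -integral_indic//; last exact: measurableI.
  apply: eq_integral => s _; congr (_%:E); rewrite !indicE; congr ((nat_of_bool _)%:R).
  apply/idP/idP; rewrite !inE /A/= !in_itv/= t01/=; first by move=> /andP[].
  by move=> [-> ->].
(* By [f_sym] the section at height [s] is the part of []0, 1[] up to [f s], of length
   [min (f s) 1 = f s]. *)
have area2 s : 0 < s < v -> (\int[mu]_t (\1_A (t, s))%:E = (f s)%:E)%E.
  move=> /andP[s0 sv]; have s01 : 0 < s < 1 by rewrite s0 (lt_le_trans sv).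
  have /andP[fs0 fs1] := f01 s.
  rewrite -[in RHS](min_idPl fs1) -area// -[X in mu X]setIT -integral_indic//.
    apply: eq_integral => t _; congr (_%:E); rewrite !indicE; congr ((nat_of_bool _)%:R).
    apply/idP/idP; rewrite !inE /A/= !in_itv/= s0 sv/= andbT.
      by move=> /andP[t01]; rewrite f_sym.
    by move=> [t01 ts]; rewrite t01 f_sym.
  exact: measurableI.
rewrite /Rintegral; congr fine.
transitivity (\int[mu]_t \int[mu]_s (\1_A (t, s))%:E)%E.
  (* The endpoints, a null set, are dropped because [A] only has abscissas in []0, 1[]. *)
  rewrite integral_itv_bndoo; last first.
    by apply/measurable_EFinP/measurable_funTS/measurable_minr.
  rewrite integral_mkcond; apply: eq_integral => t _.
  rewrite patchE; case: ifPn => [|t01]; first by rewrite inE/= in_itv/= => /area1.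
  rewrite integral0_eq// => s _; rewrite indicE memNset//= => /andP[/andP[+ _] _].
  by move: t01; rewrite notin_setE/= in_itv/=.
transitivity (\int[mu]_s \int[mu]_t (\1_A (t, s))%:E)%E.
  apply: (@fubini_tonelli _ _ _ _ R mu mu (fun z => (\1_A z)%:E)).
    by apply/measurable_EFinP; exact: measurable_indic.
  by move=> z; rewrite lee_fin.
rewrite integral_itv_bndoo; last exact/measurable_EFinP/measurable_funTS.
rewrite [RHS]integral_mkcond; apply: eq_integral => s _.
rewrite patchE; case: ifPn => [|s01]; first by rewrite inE/= in_itv/= => /area2.
rewrite integral0_eq// => t _; rewrite indicE memNset//= => /andP[/andP[_ +] _].
by move: s01; rewrite notin_setE/= in_itv/=.
Qed.

End selfinverse_integrand.

(** * Range and limits of a distribution function *)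

Section cumulative_facts.
Context {R : realType} (F : cumulativeBounded (0:R) (1:R)).

Lemma cumulativeBounded_ge0 x : 0 <= F x.
Proof.
rewrite leNgt; apply/negP => Fx0.
have [M [_ HM]] := cvgr_gt 0 (cumulativeNy F) _ Fx0.
have : F x < F (Num.min x (M - 1)).
  by apply: HM; rewrite gt_min ltrBlDr ltrDl ltr01 orbT.
by rewrite ltNge cumulative_is_nondecreasing// ge_min lexx.
Qed.

Lemma cumulativeBounded_le1 x : F x <= 1.
Proof.
rewrite leNgt; apply/negP => Fx1.
have [M [_ HM]] := cvgr_lt 1 (cumulativey F) _ Fx1.
have : F (Num.max x (M + 1)) < F x.
  by apply: HM; rewrite lt_max ltrDl ltr01 orbT.
by rewrite ltNge cumulative_is_nondecreasing// le_max lexx.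
Qed.

Lemma cumulativeBounded_lt w : 0 < w -> exists x, F x < w.
Proof.
move=> w0; have [M [_ HM]] := cvgr_lt 0 (cumulativeNy F) _ w0.
by exists (M - 1); apply: HM; rewrite ltrBlDr ltrDl.
Qed.

Lemma cumulativeBounded_gt w : w < 1 -> exists x, w < F x.
Proof.
move=> w1; have [M [_ HM]] := cvgr_gt 1 (cumulativey F) _ w1.
by exists (M + 1); apply: HM; rewrite ltrDl.
Qed.

End cumulative_facts.

(** * The quantile transform of the uniform law, and the convolution as an integral over [0, 1] *)

Section quantile_transform.
Context {R : realType} (F : cumulativeBounded (0:R) (1:R)).
Hypothesis Fcont : continuous (F : R -> R).
Notation mu := (@lebesgue_measure R).

Let F_nd : {homo (F : R -> R) : x y / x <= y}.
Proof. by move=> x y; exact: cumulative_is_nondecreasing. Qed.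

Lemma ginv_cumulative_le w x : 0 < w < 1 -> (ginv F w <= x) = (w <= F x).
Proof.
by apply: ginv_le => //; [exact: cumulativeBounded_lt|exact: cumulativeBounded_gt].
Qed.

Lemma ginv_cumulative_homo w1 w2 : 0 < w1 < 1 -> 0 < w2 < 1 -> w1 <= w2 ->
  ginv F w1 <= ginv F w2.
Proof.
by apply: ginv_homo => //; [exact: cumulativeBounded_lt
  |exact: cumulativeBounded_gt].
Qed.

(** Set to 0 outside the levels where the Galois connection holds, so that the quantile function is
    a random variable on the whole line. *)
Let q : measurableTypeR R -> measurableTypeR R := ginv F \_ `]0, 1[.

Let preimage_q b : `]0, 1[ `&` ginv F @^-1` `]-oo, b] = `]0, 1[ `&` `]-oo, F b].
Proof.
apply/seteqP; split => t /=; rewrite !in_itv/= => -[t01];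
  by rewrite ginv_cumulative_le.
Qed.

Let measurable_q : measurable_fun [set: measurableTypeR R] q.
Proof.
apply/(measurable_restrictT _ _).1 => //.
apply: (measurability (@RGenOInfty.G R)) => [|/= _ [_] [r] -> <-].
  exact: RGenOInfty.measurableE.
rewrite -[`]r, +oo[%classic]setCK setCitvr preimage_setC -setDE.
rewrite [X in measurable X](_ : _ =
    `]0, 1[ `\` (`]0, 1[ `&` ginv F @^-1` `]-oo, r])); last first.
  by rewrite setDIr setDv set0U.
rewrite preimage_q.
by apply: measurableD => //; exact: measurableI.
Qed.

#[local] HB.instance Definition _ :=
  @isMeasurableFun.Build _ _ _ _ q measurable_q.

Let unif : probability (measurableTypeR R) R := uniform_prob (@ltr01 R).

Let law : probability (measurableTypeR R) R :=
  distribution unif (q : {mfun measurableTypeR R >-> measurableTypeR R}).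

(** On []0, 1[], [q t <= b] means [t <= F b], so the mass is [min (F b) 1]. *)
Let law_cdf (b : R) : law `]-oo, b]%classic = (F b)%:E.
Proof.
have mq : measurable (q @^-1` `]-oo, b]).
  by rewrite -[X in measurable X]setTI; exact: measurable_q.
have -> : law `]-oo, b]%classic = (\int[unif]_t (\1_(q @^-1` `]-oo, b]) t)%:E)%E.
  by rewrite integral_indic// setIT.
rewrite integral_uniform//=; last exact/measurable_EFinP/measurable_indic.
rewrite subr0 invr1 mul1e integral_itv_bndoo; last first.
  exact/measurable_EFinP/measurable_indic.
rewrite integral_indic// setIC.
have -> : `]0, 1[ `&` q @^-1` `]-oo, b] = `]0, 1[ `&` `]-oo, F b].
  rewrite -preimage_q; apply/seteqP; split => t /= [t01].
    by rewrite /q patchE mem_set.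
  by rewrite /q patchE mem_set.
rewrite [LHS]lebesgue_measure_itvoo_itvNyc ?cumulativeBounded_ge0//.
by rewrite (min_idPl _)// cumulativeBounded_le1.
Qed.

(** Both measures give [F b - F a] to []a, b]], which determines them. *)
Let ls_law (A : set (measurableTypeR R)) : measurable A ->
  lebesgue_stieltjes_measure F A = law A.
Proof.
move=> mA; apply: lebesgue_stieltjes_measure_unique => // _ [[a b] _ <-].
have [ab|ba] := leP a b; last first.
  by rewrite set_itv_ge ?measure0// bnd_simp -leNgt ltW.
rewrite [RHS](_ : _ = (F b - F a)%:E); last first.
  rewrite EFinB -!law_cdf -[RHS](_ : law (`]-oo, b] `\` `]-oo, a]) = _).
    rewrite -[RHS]/(law (_ `\` _)); congr (law _).
    by rewrite -[RHS]setCK setCD setCitvl setUC -[LHS]setCK setCitv.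
  rewrite measureD//; last by rewrite -ge0_fin_numE// fin_num_measure.
  by rewrite setIidr//; exact: subset_itvl.
rewrite /lebesgue_stieltjes_measure /measure_extension/=.
by rewrite measurable_mu_extE/= ?wlength_itv_bnd//; exact: is_ocitv.
Qed.

(** Change of variables [s = q t] in the Stieltjes integral. *)
Lemma conv_selfE x :
  conv_self F x = \int[mu]_(t in `[0, 1]) F (x - ginv F t).
Proof.
have mFx : measurable_fun [set: R] (fun s => (F (x - s))%:E).
  apply/measurable_EFinP; apply: nonincreasing_measurable => // s t st.
  by apply: F_nd; rewrite lerB.
rewrite /conv_self /Rintegral; congr fine.
rewrite (eq_measure_integral law); last by move=> A mA _; exact: ls_law.
rewrite ge0_integral_distribution//=; last first.
  by move=> s; rewrite lee_fin cumulativeBounded_ge0.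
rewrite integral_uniform//=; last 2 first.
- exact: (measurableT_comp mFx measurable_q).
- by move=> t; rewrite lee_fin cumulativeBounded_ge0.
rewrite subr0 invr1 mul1e.
have mq := measurableT_comp mFx measurable_q.
have qE : {in `]0, 1[%classic, (fun t => (F (x - q t))%:E) =1
    (fun t => (F (x - ginv F t))%:E)}.
  by move=> t t01; rewrite /q patchE t01.
rewrite integral_itv_bndoo; last exact: measurable_funTS mq.
rewrite [RHS]integral_itv_bndoo; last first.
  by apply: eq_measurable_fun qE _; exact: measurable_funTS mq.
exact: eq_integral.
Qed.

End quantile_transform.

(** * Monotonicity, continuity and limits of the convolution *)

Section conv_self_facts.
Context {R : realType} (F : cumulativeBounded (0:R) (1:R)).
Hypothesis Fcont : continuous (F : R -> R).

Let P := lebesgue_stieltjes_measure F.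

Let F_nd : {homo (F : R -> R) : x y / x <= y}.
Proof. by move=> x y; exact: cumulative_is_nondecreasing. Qed.

Let measurable_shift x : measurable_fun [set: R] (fun s => F (x - s)).
Proof.
by apply: nonincreasing_measurable => // s t st; apply: F_nd; rewrite lerB.
Qed.

Let norm_shift x s : `|F (x - s)| <= 1.
Proof. by rewrite ger0_norm ?cumulativeBounded_ge0// cumulativeBounded_le1. Qed.

Let P_fin : (P [set: measurableTypeR R] < +oo)%E.
Proof. by rewrite /P probability_setT ltry. Qed.

Let integrable_shift x : P.-integrable [set: measurableTypeR R]
  (EFin \o (fun s => F (x - s))).
Proof.
apply: measurable_bounded_integrable => //; first exact: measurable_shift.
by exists 1; split => // M M1 s _ /=; rewrite (le_trans (norm_shift _ _))// ltW.
Qed.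

Let integrable_one : P.-integrable [set: measurableTypeR R] (EFin \o (fun=> 1)).
Proof.
apply: measurable_bounded_integrable => //.
by exists `|1|; split => // M M1 s _ /=; exact: ltW.
Qed.

Lemma conv_self_nondecreasing : {homo conv_self F : x y / x <= y}.
Proof.
move=> x y xy; apply: le_Rintegral => //= s _.
by apply: F_nd; rewrite lerB.
Qed.

(** Continuity under the integral sign, the constant 1 dominating the integrand near [x]. *)
Lemma conv_self_continuous : continuous (conv_self F).
Proof.
move=> x.
have : {in `]x - 1, x + 1[%classic, continuous (conv_self F)}.
  apply: (@continuity_under_integral _ _ _ P (fun y s => F (y - s)) setT
    measurableT (x - 1) (x + 1) _ _ (fun=> 1)) => //.
  - apply: (@aeW _ _ _ P) => s _ y _; apply: (@continuous_comp _ _ _ (fun z => z - s) F);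
      last exact: Fcont.
    by apply: cvgB; [exact: cvg_id|exact: cvg_cst].
  - by move=> y _; apply: (@aeW _ _ _ P) => s _; exact: norm_shift.
by apply; rewrite inE/= in_itv/= ltrBlDr !ltrDl ltr01.
Qed.

(** Dominated convergence against a probability measure, for which the constant [c] integrates to
    [c]. It yields the limits of the convolution at both infinities. *)
Let conv_self_cvg (u : nat -> R) (c : R) :
  (forall s, F (u n - s) @[n --> \oo] --> c) ->
  conv_self F (u n) @[n --> \oo] --> c.
Proof.
move=> Fuc.
have [] := @dominated_convergence _ (measurableTypeR R) R P setT measurableT
  (fun n s => (F (u n - s))%:E) (fun=> c%:E) (fun=> 1%:E) _ _ _ _ _.
- by move=> n; apply/measurable_EFinP; exact: measurable_shift.
- exact: measurable_cst.
- apply: (@aeW _ _ _ P) => s _; apply: cvg_EFin; last exact: Fuc.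
  by apply: nearW.
- exact: integrable_one.
- by apply: (@aeW _ _ _ P) => s n _; rewrite /= lee_fin; exact: norm_shift.
- move=> _ _; rewrite integral_cst//.
  rewrite [X in (_ * X)%E](_ : _ = 1%E) ?mule1; first exact: fine_cvg.
  exact: (probability_setT (lebesgue_stieltjes_measure F)).
Qed.

Lemma conv_self_lt w : 0 < w -> exists x, conv_self F x < w.
Proof.
move=> w0.
have : conv_self F (- n%:R) @[n --> \oo] --> (0 : R).
  apply: conv_self_cvg => s; apply: (cvg_comp _ _ _ (cumulativeNy F)).
  apply/cvgrNyPle => M; near=> n.
  rewrite lerBlDr lerNl; near: n; exact: nbhs_infty_ger.
by move=> /(cvgr_lt 0) /(_ _ w0)[n _ /(_ n (leqnn n))]; exists (- n%:R).
Unshelve. all: by end_near. Qed.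

Lemma conv_self_gt w : w < 1 -> exists x, w < conv_self F x.
Proof.
move=> w1.
have : conv_self F n%:R @[n --> \oo] --> (1 : R).
  apply: conv_self_cvg => s.
  apply: (cvg_comp _ _ _ (cumulativey F)).
  apply/cvgryPge => M; near=> n.
  rewrite lerBrDr; near: n; exact: nbhs_infty_ger.
by move=> /(cvgr_gt 1) /(_ _ w1)[n _ /(_ n (leqnn n))]; exists n%:R.
Unshelve. all: by end_near. Qed.

End conv_self_facts.

(** * The copula and its invariance *)

Section convolution_copula.
Context {R : realType} (F : cumulativeBounded (0:R) (1:R)).
Hypothesis Fcont : continuous (F : R -> R).
Notation mu := (@lebesgue_measure R).

(* [kfun F] with its junk values, due to [ginv] at levels outside ]0, 1[,
   replaced so that it is monotone everywhere. *)
Definition kext (u t : R) : R :=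
  if u <= 0 then 0 else if 1 <= u then 1
  else if t <= 0 then 1 else if 1 <= t then 0 else kfun F u t.

Let F_nd : {homo (F : R -> R) : x y / x <= y}.
Proof. by move=> x y; exact: cumulative_is_nondecreasing. Qed.

Let G_homo u1 u2 : 0 < u1 < 1 -> 0 < u2 < 1 -> u1 <= u2 ->
  ginv (conv_self F) u1 <= ginv (conv_self F) u2.
Proof.
apply: ginv_homo; [exact: conv_self_nondecreasing|exact: conv_self_continuous
  |exact: conv_self_lt|exact: conv_self_gt].
Qed.

Lemma kext01 u t : 0 <= kext u t <= 1.
Proof.
rewrite /kext; do 4 (case: ifP => _; first by rewrite ?lexx ?ler01).
by rewrite cumulativeBounded_ge0 cumulativeBounded_le1.
Qed.

Lemma kext_nonincreasing u : nonincreasing_fun (kext u).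
Proof.
move=> s t st; rewrite /kext; case: ifP => // _; case: ifP => // _.
have [t0|t0] := leP t 0; first by rewrite (le_trans st t0).
have [s0|s0] := leP s 0.
  case: ifP => // _; exact: cumulativeBounded_le1.
have [s1|s1] := leP 1 s; first by rewrite (le_trans s1 st).
have [t1|t1] := leP 1 t; first exact: cumulativeBounded_ge0.
apply: F_nd; rewrite lerB//; apply: ginv_cumulative_homo => //.
  by rewrite s0.
by rewrite t0.
Qed.

Lemma kext_nondecreasing t : {homo kext^~ t : u v / u <= v}.
Proof.
move=> u v uv.
have [u0|u0] := leP u 0.
  by rewrite /kext u0; have /andP[] := kext01 v t.
have [v1|v1] := leP 1 v.
  have /andP[_ /le_trans->//] := kext01 u t.
  by rewrite /kext v1 (leNgt v 0) (lt_le_trans u0 uv).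
have v0 := lt_le_trans u0 uv; have u1 := le_lt_trans uv v1.
rewrite /kext (leNgt u) (leNgt v) u0 v0 (leNgt 1 u) (leNgt 1 v) u1 v1/=.
case: ifP => // _; case: ifP => // _.
by apply: F_nd; rewrite lerB// G_homo ?u0 ?v0.
Qed.

Lemma kext_sym u s t : 0 < s < 1 -> 0 < t < 1 ->
  (s <= kext u t) = (t <= kext u s).
Proof.
move=> /[dup] s01 /andP[s0 s1] /[dup] t01 /andP[t0 t1]; rewrite /kext.
(* For [u <= 0] both sides are false; for [1 <= u] both are true. In between, both say [ginv F s +
   ginv F t <= ginv (conv_self F) u]. *)
case: ifP => _; first by rewrite leNgt s0 leNgt t0.
case: ifP => _; first by rewrite !ltW.
rewrite (leNgt s 0) (leNgt t 0) (leNgt 1 s) (leNgt 1 t) s0 s1 t0 t1/= /kfun.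
by rewrite -!ginv_cumulative_le// !lerBrDr addrC.
Qed.

Lemma CopE u v : 0 <= v <= 1 -> Cop F u v = \int[mu]_(t in `[0, v]) kext u t.
Proof.
move=> /andP[v0 v1].
have vE : v = \int[mu]_(t in `[0, v]) 1.
  rewrite Rintegral_cst//= lebesgue_measure_itv/= lte_fin mul1r.
  by move: v0; rewrite le_eqVlt => /predU1P[<-|->]; rewrite ?ltxx//= subr0.
rewrite /Cop; case: ifPn => [u0|u0].
  by under eq_Rintegral do rewrite /kext u0; rewrite Rintegral_cst// mul0r.
case: ifPn => [u1|u1].
  by under eq_Rintegral do rewrite /kext (negbTE u0) u1; rewrite -vE.
(* The junk values are avoided inside []0, v[], and the endpoints are negligible. *)
have kE : {in `]0, v[%classic, (fun t => (kext u t)%:E) =1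
    (fun t => (kfun F u t)%:E)}.
  move=> t; rewrite inE/= in_itv/= => /andP[t0 tv].
  by rewrite /kext (negbTE u0) (negbTE u1) leNgt t0 leNgt (lt_le_trans tv v1).
have mk : measurable_fun `]0, v[ (fun t => (kext u t)%:E).
  apply/measurable_EFinP; apply: nonincreasing_measurable => //.
  exact: kext_nonincreasing.
rewrite /Rintegral; congr fine.
rewrite integral_itv_bndoo; last exact: eq_measurable_fun kE mk.
rewrite [RHS]integral_itv_bndoo//.
by apply/esym/eq_integral.
Qed.

Lemma Cop_u1 u : 0 <= u <= 1 -> Cop F u 1 = u.
Proof.
move=> /andP[u0 u1]; rewrite /Cop; case: ifPn => [u0'|].
  by apply/eqP; rewrite eq_le u0 u0'.
rewrite -ltNge => {}u0; case: ifPn => [u1'|].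
  by apply/eqP; rewrite eq_le u1 u1'.
(* The integral of [kfun F u] over [0, 1] is the convolution evaluated at its own [u]-quantile. *)
rewrite -ltNge => {}u1; rewrite -[LHS]conv_selfE//; apply: ginvK.
- exact: conv_self_nondecreasing.
- exact: conv_self_continuous.
- exact: conv_self_lt.
- exact: conv_self_gt.
- by rewrite u0.
Qed.

(** The volume of a rectangle is the integral of [kext u2 - kext u1] over []v1, v2]], nonnegative by
    monotonicity in the first argument. *)
Lemma Cop_is_copula : is_copula (Cop F).
Proof.
split=> [u /[dup] u01 /andP[u0 u1]|u1 u2 v1 v2 hu1 hu2 hv1 hv2 u12 v12].
  split; first by rewrite CopE ?lexx ?ler01// set_itv1 Rintegral_set1.
  split; first by rewrite /Cop lexx.
  split; first exact: Cop_u1.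
  by rewrite /Cop leNgt ltr01 lexx.
rewrite !CopE//; move: hv1 => /andP[v10 _].
have incr u := @Rintegral_increment R (kext u) (kext_nonincreasing u) (kext01 u)
  v1 v2 v10 v12.
have fin_itv : (mu `]v1, v2] < +oo)%E.
  by rewrite lebesgue_measure_itv/=; case: ifPn => // _; rewrite -EFinB ltry.
have int_k u : mu.-integrable `]v1, v2] (EFin \o kext u).
  by apply: integrable_nonincreasing => //; [exact: kext_nonincreasing
    |exact: kext01].
have : \int[mu]_(t in `]v1, v2]) kext u1 t <= \int[mu]_(t in `]v1, v2]) kext u2 t.
  by apply: le_Rintegral => //= t _; exact: kext_nondecreasing.
rewrite -!incr -subr_ge0 opprB; congr (is_true (_ <= _)); ring.
Qed.

Lemma Cop_is_SI : is_SI (Cop F).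
Proof.
move=> v _ x y a /[dup] x01 /andP[x0 x1] /[dup] y01 /andP[y0 y1].
move=> /[dup] a01 /andP[a0 a1].
rewrite !CopE//; last first.
  have a'0 : 0 <= 1 - a by rewrite subr_ge0.
  by apply/andP; split; nra.
apply: Rintegral_nonincreasing_concave => //; first exact: kext_nonincreasing.
exact: kext01.
Qed.

Lemma partial2_Cop u : {ae mu, forall t, 0 < t < 1 ->
  partial2 (Cop F) u t = kext u t}.
Proof.
have := derive1_Rintegral_nonincreasing (kext u) (kext_nonincreasing u) (kext01 u).
apply: filterS; first exact: (ae_filter_ringOfSetsType mu).
move=> t + /andP[t0 t1] => /(_ t0) <-.
(* [CopE] covers the arguments in [0, 1], a neighbourhood of [t], which suffices for the derivative
   at [t]. *)
rewrite /partial2 !derive1E; apply: near_eq_derive.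
near=> x; apply: CopE; apply/andP; split; apply: ltW; near: x.
- exact: lt_nbhsr.
- exact: lt_nbhsl.
Unshelve. all: by end_near. Qed.

Lemma partial2_Pi v t : partial2 (@Pi R) v t = v.
Proof.
rewrite /partial2 derive1E (_ : Pi v = v *: (@idfun R)); last exact/funext.
by rewrite deriveZ//= derive_id scaler1.
Qed.

Lemma Top_Cop u v : unit_itv u -> unit_itv v -> Top (Cop F) u v = Cop F u v.
Proof.
move=> _ v01; rewrite CopE// -Rintegral_min_selfinverse//.
- rewrite /Top /cjoin /Rintegral; congr fine.
  apply: ae_eq_integral_nonmeasurable.
  (* The points 0 and 1 are discarded as null sets, the derivative being known only inside []0,
     1[]. *)
  have ae_neq (c : R) : {ae mu, forall t : R, t != c}.
    exists [set c]; split => //; first exact: lebesgue_measure_set1.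
    by move=> t /= /negP; rewrite negbK => /eqP.
  have aeF := ae_filter_ringOfSetsType mu.
  apply: filterS3 (ae_neq 0) (ae_neq 1) (partial2_Cop u) => t t0 t1 d2C.
  rewrite /= in_itv/= => /andP[t0' t1'].
  by rewrite d2C ?partial2_Pi// !lt_neqAle t0' t1' eq_sym t0 t1.
- exact: kext_nonincreasing.
- exact: kext01.
- exact: kext_sym.
Qed.

End convolution_copula.


Theorem mainTheorem14 (R : realType) (F : cumulativeBounded (0:R) (1:R))
  (Fcont : continuous (F : R -> R)) :
  is_copula (Cop F) /\ is_SI (Cop F) /\
  (forall u v : R, unit_itv u -> unit_itv v -> Top (Cop F) u v = Cop F u v).
Proof.
split; first exact: Cop_is_copula.
split; first exact: Cop_is_SI.
by move=> u v; exact: Top_Cop.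
Qed.
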